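(* For all real numbers $x\ge 1$ and $y\ge 2$, we have $f(x,y)\ge A(x/2,y)$.
   Context: A chain is a finite sequence of pairwise distinct positive integers such that for any two consecutive terms, the smaller divides the larger; its length is its number of terms. For an integer $n\ge 2$, $P(n)$ denotes its largest prime factor, and $P(1)=1$. Let $\mathcal S(x,y)=\{n\le x: P(n)\le y\}$ and let $f(x,y)$ be the maximum length of a chain of integers of $\mathcal S(x,y)$. For $n\ge2$ written $n=p_1(n)p_2(n)\cdots p_{\Omega(n)}(n)$ with primes $p_1(n)\ge p_2(n)\ge\cdots\ge p_{\Omega(n)}(n)$, the Schinzel–Szekeres function is $S(n)=\max_{1\le k\le\Omega(n)} p_1(n)\cdots p_{k-1}(n)p_k(n)^2$, and $S(1)=1$. Let $A(x,y)=|\{n\ge1: P(n)\le y,\ S(n)\le x\}|$. *)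

(* Defs.v *)
From HB Require Import structures.
From mathcomp Require Import all_boot all_order all_algebra finmap.
From mathcomp Require Import all_classical reals.

Set Implicit Arguments.
Unset Strict Implicit.
Unset Printing Implicit Defensive.

Import Order.TTheory GRing.Theory Num.Theory.

Local Open Scope classical_set_scope.
Local Open Scope nat_scope.

Definition is_chain (c : seq nat) : bool :=
  [&& uniq c, all (fun n => 0 < n) c
    & sorted (fun m n => minn m n %| maxn m n) c].

(* P(n) is the library's [max_pdiv n], which is 1 for n = 1. *)
Definition smooth_set (R : realType) (x y : R) : set nat :=
  [set n | [/\ 0 < n, (n%:R <= x)%R & ((max_pdiv n)%:R <= y)%R]].

Definition chain_lengths (R : realType) (x y : R) : set nat :=
  [set size c | c in [set c : seq nat
                       | is_chain c /\ {in c, forall n, smooth_set x y n}]].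

(* [chain_lengths x y] is finite ([finite_chain_lengths]), so that this is a
   genuine maximum (see [max_chainP]) as soon as it is nonempty; the empty
   chain always belongs to it. *)
Definition max_chain (R : realType) (x y : R) : nat :=
  \max_(l <- fset_set (chain_lengths x y)) l.

(* p_1(n) >= ... >= p_Omega(n), with multiplicity; [prime_decomp n] lists the
   pairs (prime, exponent) by increasing primes. *)
Definition prime_factors (n : nat) : seq nat :=
  rev (flatten [seq nseq pe.2 pe.1 | pe <- prime_decomp n]).

(* Indices are shifted: [k] below stands for k - 1 in the usual formula. *)
Definition schinzel_szekeres (n : nat) : nat :=
  let p := prime_factors n in
  if n == 1 then 1
  else \max_(k < size p) ((\prod_(i < k) nth 0 p i) * nth 0 p k ^ 2).

Definition A_set (R : realType) (x y : R) : set nat :=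
  [set n | [/\ 0 < n, ((max_pdiv n)%:R <= y)%R
             & ((schinzel_szekeres n)%:R <= x)%R]].

(* [fset_set] is empty on infinite sets, but [A_set x y] is finite
   ([finite_A_set]). *)
Definition A_card (R : realType) (x y : R) : nat := #|` fset_set (A_set x y)|.

Lemma prod_prime_factors (n : nat) :
  0 < n -> \prod_(p <- prime_factors n) p = n.
Proof.
move=> n0; rewrite (perm_big _ (permEl (perm_rev _))) /= big_flatten big_map.
rewrite {2}(prod_prime_decomp n0); apply: eq_bigr => pe _.
by rewrite big_nseq iter_muln_1.
Qed.

Lemma prime_prime_factors (n : nat) : {in prime_factors n, forall p, prime p}.
Proof.
move=> p; rewrite mem_rev => /flattenP[s /mapP[[q e] qe ->]] /= /nseqP[-> _].
by have [] := mem_prime_decomp qe.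
Qed.

Lemma sorted_prime_factors (n : nat) : sorted geq (prime_factors n).
Proof.
rewrite rev_sorted.
have : sorted ltn [seq pe.1 | pe <- prime_decomp n] := sorted_primes n.
elim: (prime_decomp n) => [//|[q e] s IH] /= ps.
have {}IH := IH (path_sorted ps).
rewrite sorted_pairwise; last by move=> a b c /=; apply: leq_trans.
rewrite pairwise_cat -(sorted_pairwise leq_trans) -(sorted_pairwise leq_trans).
rewrite IH andbT; apply/andP; split; last first.
  by elim: e {ps} => [//|[//|e] IHe] /=; rewrite leqnn.
apply/allrelP => a b /nseqP[-> _] /flattenP[t /mapP[[r f] rf ->]] /=.
move=> /nseqP[-> _]; move: ps; rewrite (path_sortedE ltn_trans) => /andP[/allP h _].
by apply/ltnW/h/mapP; exists (r, f).
Qed.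

Lemma leq_schinzel_szekeres (n : nat) : n <= schinzel_szekeres n.
Proof.
rewrite /schinzel_szekeres; case: eqP => [->//|/eqP n1].
have [->//|n0] := posnP n.
have := prod_prime_factors n0; have := @prime_prime_factors n.
case/lastP: (prime_factors n) => [|s p] pr E.
  by rewrite -E big_nil eqxx in n1.
have hs : size s < size (rcons s p) by rewrite size_rcons.
apply: leq_trans (leq_bigmax (Ordinal hs)) => /=.
rewrite nth_rcons ltnn eqxx -E big_rcons /=.
rewrite (big_nth 0) big_mkord.
apply: leq_mul.
  by apply: leq_prod => i _; rewrite nth_rcons ltn_ord.
rewrite leq_pmulr // prime_gt0 // pr //.
by rewrite mem_rcons mem_head.
Qed.

Lemma finite_A_set (R : realType) (x y : R) : finite_set (A_set x y).
Proof.
apply: (@sub_finite_set _ _ `I_(Num.truncn x).+1); last exact: finite_II.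
move=> n [n0 _ h] /=; rewrite ltnS.
apply: leq_trans (leq_schinzel_szekeres n) _.
by rewrite truncn_ge_nat // (le_trans _ h).
Qed.

Lemma finite_chain_lengths (R : realType) (x y : R) :
  finite_set (chain_lengths x y).
Proof.
apply: (@sub_finite_set _ _ `I_(Num.truncn x).+2); last exact: finite_II.
move=> _ [c [/and3P[uc _ _] cS] <-] /=; rewrite ltnS.
rewrite -(size_iota 0 (Num.truncn x).+1); apply: uniq_leq_size => // n /cS[n0 nx _].
by by rewrite mem_iota /= add0n ltnS truncn_ge_nat // (le_trans _ nx).
Qed.

Lemma max_chainP (R : realType) (x y : R) :
  chain_lengths x y (max_chain x y) /\
  forall l, chain_lengths x y l -> l <= max_chain x y.
Proof.
have fin := finite_chain_lengths x y.
split; last first.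
  move=> l hl; rewrite /max_chain (@leq_bigmax_seq _ _ xpredT id) //.
  by rewrite in_fset_set // inE.
rewrite /max_chain big_seq; elim/big_ind : _ => [|m n hm hn|l].
- by exists [::].
- by rewrite /maxn; case: ifP.
- by rewrite in_fset_set // inE.
Qed.

(* Main.v *)
(* With X = x/2, the integers with S(n) <= X and largest prime factor p <= sqrt X
   are the products p m with P(m) <= p and S(m) <= X/p, so induction provides,
   for each odd prime p <= min(y, sqrt X), a chain C_p of S(x/p, p) starting
   at 1 and containing all these m.  The blocks p C_p are visited by decreasing
   p after 1, and are followed by the powers of 2.  To pass from p C_p to the
   next block b C_b, which starts at b: if p b^2 <= X, let C_p end at b, since
   b | pb; otherwise let C_p end at 2 and insert 2pb.  This is at most
   2 p^2 <= x, and it is new: 2b does not occur in C_p because the odd prime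
   factors of the elements of C_p are at most sqrt(X/p).  The induction thus
   needs chains with a prescribed last term e.  For e = 2 or 4, reorder the
   powers of 2.  For an odd prime e, skip the block of e in the descent, end the
   powers of 2 at 2, and append the reversal of e C_e, from 2e to e. *)
Require Import Defs.
From mathcomp Require Import all_boot all_order all_algebra.
From mathcomp Require Import reals.
From mathcomp Require Import finmap all_classical zify.

Set Implicit Arguments.
Unset Strict Implicit.
Unset Printing Implicit Defensive.

Import Order.TTheory GRing.Theory Num.Theory.

Section NatChains.
Local Open Scope nat_scope.

(** * Divisibility links and largest prime factors *)

Definition linked m n := minn m n %| maxn m n.

Lemma linkedC m n : linked m n = linked n m.
Proof. by rewrite /linked minnC maxnC. Qed.

Lemma dvdn_linked m n : 0 < n -> m %| n -> linked m n.
Proof.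
move=> n0 mn; have le_mn := dvdn_leq n0 mn.
by rewrite /linked (minn_idPl le_mn) (maxn_idPr le_mn).
Qed.

Lemma linkedM a m n : linked m n -> linked (a * m) (a * n).
Proof. by rewrite /linked -minnMr -maxnMr; apply: dvdn_mul. Qed.

Lemma max_pdivM p m : prime p -> 0 < m -> max_pdiv m <= p ->
  max_pdiv (p * m) = p.
Proof.
move=> pp m0 mp; have p0 := prime_gt0 pp; apply/eqP; rewrite eqn_leq.
have pm1 : 1 < p * m.
  by apply: leq_trans (prime_gt1 pp) _; rewrite leq_pmulr.
rewrite max_pdiv_max ?mem_primes ?pp ?muln_gt0 ?p0 ?m0 ?dvdn_mulr // andbT.
have := max_pdiv_prime pm1; set q := max_pdiv _ => qp.
have : q %| p * m by apply: max_pdiv_dvd.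
rewrite Euclid_dvdM // => /orP[|qm]; first by rewrite dvdn_prime2 // => /eqP->.
by apply: leq_trans mp; rewrite max_pdiv_max // mem_primes qp m0.
Qed.

Lemma max_pdiv_pow2 i : max_pdiv (2 ^ i) <= 2.
Proof.
case: i => [//|i]; rewrite leqNgt; apply/negP => h.
have pq : prime (max_pdiv (2 ^ i.+1)).
  by apply: max_pdiv_prime; apply: leq_trans (ltn_expl i.+1 (ltnSn 1)).
have := max_pdiv_dvd (2 ^ i.+1); rewrite Euclid_dvdX // dvdn_prime2 //.
by rewrite (gtn_eqF h).
Qed.

(* For [s] the decreasing list of prime factors of [n], this says that
   [2 * S(n) <= N]; note that [2 * m <= N %/ p] iff [2 * (p * m) <= N]. *)
Fixpoint dense_word N s :=
  if s is p :: s' then (2 * p ^ 2 <= N) && dense_word (N %/ p) s' else true.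

(** * Requirements on the chains built by induction *)

Definition covers N M c := forall s, all prime s -> path geq M s ->
  dense_word N s -> \prod_(p <- s) p \in (c : seq nat).

(** The last clause is carried through the induction because it keeps the linking integer
    [2 * a * b] out of the block of [a] when [N %/ a < 2 * b ^ 2]. *)
Definition admissible N M n :=
  [&& 0 < n, n <= N, max_pdiv n <= M
    & (max_pdiv n <= 2) || (2 * max_pdiv n ^ 2 <= N)].

Definition block_prime N p := [&& prime p, 2 < p & 2 * p ^ 2 <= N].

Definition spanning_chain N M e := exists c,
  [/\ path linked 1 c, last 1 c = e, uniq (1 :: c),
      all (admissible N M) (1 :: c) & covers N M (1 :: c)].

Definition allowed_end N M e :=
  (e \in [:: 2; 4]) || (block_prime N e && (e <= M)).

(** * Blocks of multiples of an odd prime and their concatenation *)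

Lemma block_prime_div N a : block_prime N a -> 4 <= N %/ a < N.
Proof.
move=> /and3P[pa a2 aN]; have a0 : 0 < a by lia.
have h : 4 * a <= N by rewrite (leq_trans _ aN) // expnS expn1 mulnA leq_pmul2r; lia.
by rewrite leq_divRL // h ltn_Pdiv ?prime_gt1; lia.
Qed.

(* The clause on [2 * a * b] makes that integer available to link the block
   of [a] to the block of [b]. *)
Lemma dilated_chain N a e : block_prime N a -> spanning_chain (N %/ a) a e ->
  exists c,
  [/\ path linked a c, last a c = a * e, uniq (a :: c),
      all (fun n => [&& 0 < n, n <= N & max_pdiv n == a]) (a :: c)
    & (forall b, prime b -> 2 < b -> N %/ a < 2 * b ^ 2 ->
         2 * a * b \notin a :: c) /\
      (forall s, all prime s -> path geq a s -> dense_word (N %/ a) s ->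
         \prod_(p <- a :: s) p \in a :: c)].
Proof.
move=> /and3P[pa a2 aN] [c [pc lc uc ac cc]].
have a0 : 0 < a by apply: prime_gt0.
have E : a :: map (muln a) c = map (muln a) (1 :: c) by rewrite /= muln1.
have inj : injective (muln a) by move=> u v /eqP; rewrite eqn_pmul2l // => /eqP.
exists (map (muln a) c); rewrite E; split.
- rewrite -{1}[a]muln1 path_map; apply: sub_path pc => m n; exact: linkedM.
- by rewrite -{1}[a]muln1 last_map lc.
- by rewrite (map_inj_uniq inj).
- rewrite all_map; apply/allP => n /(allP ac) /and4P[n0 nN nM _] /=.
  by rewrite max_pdivM // eqxx andbT muln_gt0 a0 n0 mulnC -leq_divRL.
- split=> [b pb b2 Nb|s ps pas ds]; last first.
    by rewrite big_cons (mem_map inj) cc.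
  (* After cancelling [a], it remains to exclude [2 * b] from [1 :: c]; its largest prime factor [b]
     violates both alternatives in the last clause of [admissible]. *)
  rewrite mulnAC mulnC (mem_map inj); apply/negP => /(allP ac) /and4P[_ _ _].
  rewrite mulnC max_pdivM // ?(ltnW b2) //.
  by rewrite leqNgt b2 /= leqNgt Nb.
Qed.

(** Blocks of distinct primes are disjoint, since the largest prime factor identifies the block. The
    last term is [e] times the last prime of [a :: l]; divisibility by [e] suffices to continue with
    [e] itself. *)
Lemma descending_chain N a l e :
    (forall b e', block_prime N b -> allowed_end (N %/ b) b e' ->
       spanning_chain (N %/ b) b e') ->
    all (block_prime N) (a :: l) -> path gtn a l -> e \in [:: 2; 4] ->
  exists c,
  [/\ path linked a c, e %| last a c, uniq (a :: c),
      all (fun n => [&& 0 < n, n <= N & max_pdiv n \in a :: l]) (a :: c)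
    & forall b s, b \in a :: l -> all prime s -> path geq b s ->
        dense_word (N %/ b) s -> \prod_(p <- b :: s) p \in a :: c].
Proof.
move=> IH; elim: l a => [|b l IHl] a /andP[ha hl] pl he.
  have [|c [pc lc uc ac [_ cc]]] := dilated_chain ha (IH _ e ha _).
    by rewrite /allowed_end he.
  exists c; split=> //; first by rewrite lc dvdn_mull.
    by apply: sub_all ac => n; rewrite inE.
  by move=> b s; rewrite inE => /eqP->; apply: cc.
have [ba pl'] := andP pl.
have [d [pd ld ud ad cd]] := IHl b hl pl' he.
have /andP[hb _] := hl.
have /and3P[pa a2 aN] := ha; have /and3P[pb b2 bN] := hb.
have a0 : 0 < a by apply: prime_gt0.
have b0 : 0 < b by apply: prime_gt0.
have lt_a n : n \in b :: l -> n < a.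
  rewrite inE => /predU1P[->//|nl]; apply: leq_ltn_trans ba.
  have : path geq b l by apply: sub_path pl' => u v /ltnW.
  rewrite path_sortedE; last by move=> u v w /= h1 h2; apply: leq_trans h2 h1.
  by move=> /andP[/allP/(_ _ nl)].
have [c0 [pc0 lc0 uc0 ac0 cc0]] : exists c,
  [/\ path linked a c, linked (last a c) b, uniq (a :: c),
      all (fun n => [&& 0 < n, n <= N & max_pdiv n == a]) (a :: c)
    & (forall s, all prime s -> path geq a s -> dense_word (N %/ a) s ->
         \prod_(p <- a :: s) p \in a :: c)].
  have [bnat|bnat] := leqP (2 * b ^ 2) (N %/ a).
    have [|c [pc lc uc ac [_ cc]]] := dilated_chain ha (IH _ b ha _).
      by rewrite /allowed_end /block_prime pb b2 bnat (ltnW ba) orbT.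
    by exists c; split=> //; rewrite lc linkedC dvdn_linked ?dvdn_mull ?muln_gt0 ?a0 ?b0.
  (* Here [b] is too large to be an end for the bound [N %/ a]. The block ends at [2 * a], and
     [2 * a * b] is a multiple of both [2 * a] and the next term [b]. *)
  have [|c [pc lc uc ac [nc cc]]] := dilated_chain ha (IH _ 2 ha _).
    by rewrite /allowed_end inE.
  exists (rcons c (2 * a * b)); split.
  - rewrite rcons_path pc lc /= dvdn_linked ?muln_gt0 ?a0 ?b0 //.
    by rewrite [a * 2]mulnC dvdn_mulr.
  - by rewrite last_rcons linkedC dvdn_linked ?dvdn_mull ?muln_gt0 ?a0 ?b0.
  - by rewrite -rcons_cons rcons_uniq nc.
  - rewrite -rcons_cons all_rcons ac andbT !muln_gt0 a0 b0 /=; apply/andP; split.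
      (* Since [b < a], the new integer is at most [2 * a ^ 2]. *)
      apply: leq_trans aN; rewrite expnS expn1 mulnA leq_pmul2l ?muln_gt0 ?a0 //.
      exact: ltnW.
    apply/eqP; rewrite [2 * a]mulnC -mulnA max_pdivM ?muln_gt0 ?b0 //.
    by rewrite mulnC max_pdivM // ltnW.
  - by move=> s *; rewrite -rcons_cons mem_rcons inE cc ?orbT.
have Ecat : a :: c0 ++ b :: d = (a :: c0) ++ b :: d by [].
exists (c0 ++ b :: d); rewrite Ecat; split.
- by rewrite cat_path pc0 /= lc0.
- by rewrite last_cat.
- rewrite cat_uniq uc0 ud andbT; apply/hasPn => n /(allP ad).
  move=> /and3P[_ _ /lt_a nb]; apply/negP => /(allP ac0) /and3P[_ _ /eqP E].
  by rewrite E ltnn in nb.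
- rewrite all_cat; apply/andP; split.
    by apply: sub_all ac0 => n /and3P[-> -> /eqP->]; rewrite mem_head.
  by apply: sub_all ad => n /and3P[-> -> nb]; rewrite inE nb orbT.
- move=> b' s; rewrite inE => /predU1P[->|b'l] *; rewrite mem_cat.
    by rewrite cc0.
  by rewrite cd ?orbT.
Qed.

(** * Powers of 2 *)

Lemma pow2_path i s : all (fun n => n == 2 ^ logn 2 n) s ->
  path linked (2 ^ i) s.
Proof.
elim: s i => [//|n s IH] i /= /andP[/eqP-> hs]; rewrite IH // andbT.
have [ij|/ltnW ji] := leqP i (logn 2 n).
  by rewrite dvdn_linked ?expn_gt0 // dvdn_exp2l.
by rewrite linkedC dvdn_linked ?expn_gt0 // dvdn_exp2l.
Qed.

(** The order is [e'], 8, 16, ..., [e], where [e'] is the other element of 2 and 4. The term 1 stays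
    outside the path, because the odd blocks go between 1 and [e']. *)
Lemma pow2_chain N e : 4 <= N -> e \in [:: 2; 4] -> exists e' c,
  [/\ e' \in [:: 2; 4], path linked e' c, last e' c = e, uniq (1 :: e' :: c)
    & forall n, n \in 1 :: e' :: c <-> exists2 i, n = 2 ^ i & 2 ^ i <= N].
Proof.
move=> N4 he; set K := trunc_log 2 N.
have K2 : 2 <= K by apply: trunc_log_max.
set w := [seq 2 ^ i | i <- iota 3 (K - 2)].
have [e' he' pe] : exists2 e', e' \in [:: 2; 4] &
    perm_eq (1 :: e' :: rcons w e) [seq 2 ^ i | i <- iota 0 K.+1].
  have -> : [seq 2 ^ i | i <- iota 0 K.+1] = [:: 1; 2; 4] ++ w.
    have -> : K.+1 = 3 + (K - 2) by lia.
    by rewrite iotaD map_cat.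
  move: he; rewrite !inE => /orP[]/eqP->; [exists 4 | exists 2] => //;
    rewrite perm_cons.
    rewrite -rcons_cons perm_rcons /=.
    by rewrite perm_refl.
  by rewrite perm_cons perm_rcons perm_refl.
exists e', (rcons w e); split=> //.
- have -> : e' = 2 ^ logn 2 e' by move: he'; rewrite !inE => /orP[]/eqP->.
  apply: pow2_path; rewrite all_rcons; apply/andP; split.
    by move: he; rewrite !inE => /orP[]/eqP->.
  by apply/allP => _ /mapP[i _ ->]; rewrite pfactorK.
- by rewrite last_rcons.
- rewrite (perm_uniq pe) map_inj_uniq ?iota_uniq // => i j /eqP.
  by rewrite eqn_exp2l // => /eqP.
- move=> n; rewrite (perm_mem pe); split=> [/mapP|] [i].
    rewrite mem_iota /= add0n ltnS => iK ->; exists i => //.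
    apply: leq_trans (trunc_logP (ltnSn 1) _); first by rewrite leq_exp2l.
    exact: leq_trans N4.
  move=> -> iN; apply/mapP; exists i => //; rewrite mem_iota /= add0n ltnS.
  by apply: trunc_log_max.
Qed.

(** * Assembly of the blocks and the induction *)

(** The terms are 1, the blocks of [l] in decreasing order, then the powers of 2 from [e']. The list
    [l] is a parameter so that the block of an odd prescribed end can be left out. *)
Lemma core_chain N l e :
    (forall b e', block_prime N b -> allowed_end (N %/ b) b e' ->
       spanning_chain (N %/ b) b e') ->
    4 <= N -> all (block_prime N) l -> sorted gtn l -> e \in [:: 2; 4] ->
  exists c,
  [/\ path linked 1 c, last 1 c = e, uniq (1 :: c),
      all (fun n => [&& 0 < n, n <= N
                      & (max_pdiv n <= 2) || (max_pdiv n \in l)]) (1 :: c)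
    & (forall i, 2 ^ i <= N -> 2 ^ i \in 1 :: c) /\
      (forall b s, b \in l -> all prime s -> path geq b s ->
        dense_word (N %/ b) s -> \prod_(p <- b :: s) p \in 1 :: c)].
Proof.
move=> IH N4 hl sl he.
have [e' [w [he' pw lw uw mw]]] := pow2_chain N4 he.
have e'0 : 0 < e' by move: he'; rewrite !inE => /orP[]/eqP->.
have [d [pd ud ad cd]] : exists d,
  [/\ path linked 1 d && linked (last 1 d) e', uniq d,
      all (fun n => [&& 0 < n, n <= N & max_pdiv n \in l]) d
    & forall b s, b \in l -> all prime s -> path geq b s ->
        dense_word (N %/ b) s -> \prod_(p <- b :: s) p \in d].
  case: l hl sl => [|a l] hl sl.
    by exists [::]; split=> //=; rewrite dvdn_linked.
  have [d [pd ld ud ad cd]] := descending_chain IH hl sl he'.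
  exists (a :: d); split=> //=; rewrite pd /=.
  have /allP h := ad.
  rewrite [linked _ e']linkedC !dvdn_linked //.
    by have /and3P[] := h _ (mem_last _ _).
  by have /and3P[] := h _ (mem_head _ _).
(* Moving 1 next to [e' :: w] gathers all the powers of 2, as [mw] describes them. *)
have E : perm_eq (1 :: d ++ e' :: w) (d ++ 1 :: e' :: w).
  by rewrite -cat_cons -cat_rcons perm_cat2r perm_sym perm_rcons.
exists (d ++ e' :: w); split.
- by have /andP[pd1 pd2] := pd; rewrite cat_path pd1 /= pd2.
- by rewrite last_cat.
- rewrite (perm_uniq E) cat_uniq ud uw andbT; apply/hasPn => n /mw[i -> _].
  apply/negP => /(allP ad) /and3P[_ _ /(allP hl) /and3P[_]].
  by rewrite ltnNge max_pdiv_pow2.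
- rewrite (perm_all _ E) all_cat; apply/andP; split.
    by apply: sub_all ad => n /and3P[-> -> ->]; rewrite orbT.
  by apply/allP => n /mw[i -> iN]; rewrite expn_gt0 iN max_pdiv_pow2.
- split=> [i iN|b s *]; rewrite (perm_mem E) mem_cat.
    by apply/orP; right; apply/mw; exists i.
  by rewrite cd.
Qed.

(** This treats the words that start with no odd prime: each entry is 2, and density keeps each
    successive quotient of [N] positive. *)
Lemma prod_pow2 N M s : all prime s -> path geq M s -> dense_word N s ->
  0 < N -> M <= 2 -> exists2 i, \prod_(p <- s) p = 2 ^ i & 2 ^ i <= N.
Proof.
elim: s N M => [|p s IH] N M /=; first by exists 0; rewrite ?big_nil.
move=> /andP[pp ps] /andP[pM pas] /andP[pN ds] N0 M2.
have E : p = 2 by have := prime_gt1 pp; lia.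
have hN : 0 < N %/ p by rewrite divn_gt0; nia.
have [i Ei iN] := IH _ _ ps pas ds hN (leq_trans pM M2).
exists i.+1; first by rewrite big_cons Ei E expnS.
by rewrite expnS mulnC -leq_divRL // (leq_trans iN) // E.
Qed.

(** Strong induction on [N], as every block prime [b] leads to the smaller bound [N %/ b], which is
    still at least 4. *)
Lemma spanning_chain_exists N M e : 4 <= N -> 2 <= M -> allowed_end N M e ->
  spanning_chain N M e.
Proof.
elim/ltn_ind: N M e => N IHN M e N4 M2 he.
have IH b e' : block_prime N b -> allowed_end (N %/ b) b e' ->
    spanning_chain (N %/ b) b e'.
  move=> hb; have /andP[h4 hN] := block_prime_div hb.
  by apply: IHN => //; have /and3P[_ /ltnW] := hb.
have N0 : 0 < N by lia.
set L := [seq p <- rev (iota 0 M.+1) | block_prime N p].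
have memL p : (p \in L) = block_prime N p && (p <= M).
  by rewrite mem_filter mem_rev mem_iota /= add0n ltnS.
have sub l : subseq l L -> all (block_prime N) l /\ sorted gtn l.
  move=> lL; split.
    by apply/allP => p /(mem_subseq lL); rewrite memL => /andP[].
  have tr : transitive gtn by move=> u v w /= h1 h2; apply: ltn_trans h2 h1.
  apply: (subseq_sorted tr lL); apply: sorted_filter => //.
  by rewrite rev_sorted iota_ltn_sorted.
have adm (l c : seq nat) : {subset l <= L} ->
    all (fun n => [&& 0 < n, n <= N
                    & (max_pdiv n <= 2) || (max_pdiv n \in l)]) c ->
    all (admissible N M) c.
  move=> lL; apply: sub_all => n /and3P[n0 nN]; rewrite /admissible n0 nN /=.
  case/orP=> [h|/lL]; first by rewrite h (leq_trans h).
  by rewrite memL => /andP[/and3P[_ _ ->] ->]; rewrite orbT.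
(* A word is sorted by its first prime: if that is odd, the product lies in its block; otherwise the
   product is a power of 2, with [2 ^ 0] for the empty word. *)
have cov c : (forall i, 2 ^ i <= N -> 2 ^ i \in c) ->
    (forall b s, b \in L -> all prime s -> path geq b s ->
        dense_word (N %/ b) s -> \prod_(p <- b :: s) p \in c) ->
    covers N M c.
  move=> c2 cL [|b s] ps pas ds; first by rewrite big_nil (c2 0).
  have [b2|b2] := leqP b 2.
    have pas2 : path geq 2 (b :: s) by move: pas => /= /andP[_ ->]; rewrite b2.
    by have [i -> /c2] := prod_pow2 ps pas2 ds N0 (leqnn _).
  move: ps pas ds => /= /andP[pb ps] /andP[bM pas] /andP[bN ds].
  by apply: cL => //; rewrite memL /block_prime pb b2 bN.
have [e24|e24] := boolP (e \in [:: 2; 4]).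
  have [hL sL] := sub L (subseq_refl L).
  have [c [pc lc uc ac [c2 cc]]] := core_chain IH N4 hL sL e24.
  by exists c; split=> //; [apply: adm ac | apply: cov].
have {e24} /andP[ho eM] : block_prime N e && (e <= M).
  by move: he; rewrite /allowed_end (negPf e24).
have /and3P[pe e2 eN] := ho.
have e0 : 0 < e by apply: prime_gt0.
have [hl sl] := sub _ (rem_subseq e L).
have [c [pc lc uc ac [c2 cc]]] := core_chain IH N4 hl sl (mem_head 2 _).
have uL : uniq L by rewrite filter_uniq // rev_uniq iota_uniq.
(* The block of [e] runs from [e] to [2 * e]; reversed, it can follow the final 2 of the core chain
   and ends at [e]. *)
have [|d [pd ld ud ad [_ cd]]] := dilated_chain ho (IH _ 2 ho _).
  by rewrite /allowed_end mem_head.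
have E : perm_eq (1 :: c ++ rev (e :: d)) ((1 :: c) ++ e :: d).
  by rewrite -cat_cons perm_cat2l perm_rev.
exists (c ++ rev (e :: d)); split.
- rewrite cat_path pc lc lastI rev_rcons /= ld.
  rewrite dvdn_linked ?dvdn_mull ?muln_gt0 ?e0 //= -ld rev_path.
  by rewrite (@eq_path _ _ linked) // => u v; rewrite linkedC.
- by rewrite last_cat rev_cons last_rcons.
- rewrite (perm_uniq E) cat_uniq uc ud andbT; apply/hasPn => n /(allP ad).
  move=> /and3P[_ _ /eqP En]; apply/negP => /(allP ac) /and3P[_ _].
  (* Core terms have largest prime factor at most 2 or in [rem e L], which no longer contains [e]
     because [L] has no repetition. *)
  by rewrite En mem_rem_uniq // inE eqxx orbF leqNgt e2.
- rewrite (perm_all _ E) all_cat (adm _ _ _ ac) ?andTb; last by move=> n /mem_rem.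
  apply: (adm L); first by [].
  apply: sub_all ad => n /and3P[-> -> /eqP->].
  by rewrite memL ho eM orbT.
- apply: cov => [i iN|b s bL *]; rewrite (perm_mem E) mem_cat.
    by rewrite c2.
  have [Eb|nb] := eqVneq b e; first by subst b; rewrite cd ?orbT.
  by rewrite cc // mem_rem_uniq // inE nb.
Qed.

(** * From the Schinzel-Szekeres function to dense words *)

Lemma prime_factors_dense_word N n : 0 < n ->
    2 * schinzel_szekeres n <= N ->
  path geq (max_pdiv n) (prime_factors n) /\ dense_word N (prime_factors n).
Proof.
move=> n0 hS; split.
  have := sorted_prime_factors n.
  case E : (prime_factors n) => [//|p s] /= ->; rewrite andbT.
  have pn : p \in prime_factors n by rewrite E mem_head.
  apply: max_pdiv_max; rewrite mem_primes n0 (prime_prime_factors pn) /=.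
  by rewrite -(prod_prime_factors n0) E big_cons dvdn_mulr.
(* Splitting the maximum into its terms gives a statement about arbitrary lists of primes, fit for
   induction on the list with [N] varying. *)
have {hS} : forall k, k < size (prime_factors n) ->
    2 * ((\prod_(i < k) nth 0 (prime_factors n) i)
         * nth 0 (prime_factors n) k ^ 2) <= N.
  move=> k hk; apply: leq_trans hS; rewrite leq_mul2l /= /schinzel_szekeres.
  case: eqP => [n1|_]; first by rewrite n1 in hk.
  exact: (leq_bigmax (Ordinal hk)).
have := @prime_prime_factors n.
elim: (prime_factors n) N => [//|p s IH] N ps hs /=; apply/andP; split.
  by have := hs 0 isT; rewrite big_ord0 mul1n.
have p0 : 0 < p by apply: prime_gt0; apply: ps; rewrite mem_head.
apply: IH => [q qs|k ks]; first by apply: ps; rewrite inE qs orbT.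
(* Term [k.+1] for [p :: s] and [N] becomes term [k] for [s] and [N %/ p] on division by [p]. *)
have := hs k.+1 ks; rewrite big_ord_recl /= leq_divRL // => h.
by apply: leq_trans h; rewrite mulnC !mulnA [p * 2]mulnC.
Qed.

End NatChains.

(** * Passage to real bounds *)

Local Open Scope ring_scope.

Theorem theorem1p1 (R : realType) (x y : R) (hx : 1 <= x) (hy : 2 <= y) :
  (A_card (x / 2) y <= max_chain x y)%N.
Proof.
set N := Num.truncn x; set M := Num.truncn y.
have leN n : (n <= N)%N = (n%:R <= x) by rewrite truncn_ge_nat // (le_trans _ hx).
have leM n : (n <= M)%N = (n%:R <= y) by rewrite truncn_ge_nat // (le_trans _ hy).
have M2 : (2 <= M)%N by rewrite leM.
have [c [cc cS cA]] : exists c : seq nat,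
    [/\ is_chain c, {in c, forall n, smooth_set x y n}
      & forall n, A_set (x / 2) y n -> n \in c].
  have hA n : A_set (x / 2) y n ->
      [/\ (0 < n)%N, (max_pdiv n <= M)%N & (2 * schinzel_szekeres n <= N)%N].
    move=> [n0 nM nS]; rewrite n0 leM nM leN natrM; split=> //.
    by rewrite mulrC -ler_pdivlMr.
  have [N4|N4] := leqP 4 N.
    (* Any allowed end would do; 2 is allowed for all bounds. *)
    have [|c [pc _ uc ac cc]] := @spanning_chain_exists N M 2 N4 M2.
      by rewrite /allowed_end mem_head.
    exists (1%N :: c); split.
    - apply/and3P; split=> //; first by apply: sub_all ac => n /and4P[].
    - by move=> n /(allP ac) /and4P[n0 nN nM _]; split=> //; rewrite -?leN -?leM.
    - move=> n /hA[n0 nM nS].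
      have [pn dn] := prime_factors_dense_word n0 nS.
      rewrite -(prod_prime_factors n0); apply: cc => //.
        by apply/allP/prime_prime_factors.
      by case: (prime_factors n) pn => //= p s /andP[pn ->]; rewrite (leq_trans pn).
  (* For [N < 4], the bounds [n <= S(n)] and [2 * S(n) <= N] force [n = 1]. *)
  exists [:: 1%N]; split=> // [n|n /hA[n0 _ nS]]; rewrite inE.
    by move=> /eqP->; split=> //; rewrite -leM ltnW.
  by have := leq_schinzel_szekeres n; rewrite eqn_leq n0 andbT; lia.
apply: (@leq_trans (size c)).
  apply: uniq_leq_size; first exact: fset_uniq.
  by move=> n; rewrite in_fset_set ?inE; [apply: cA | apply: finite_A_set].
by apply: (max_chainP x y).2; exists c.
Qed.
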